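(* Let $m\ge1$, $\vec t=(t_1,\dots,t_m)$ with $t_1<\cdots<t_m$ real, and $\omega_0,\dots,\omega_m$ real with $\sum_{k=0}^\ell\omega_k\ge0$ for $\ell=0,\dots,m$, such that $w(x;\vec t)={\rm e}^{-x^2}\big(\omega_0+\sum_{k=1}^m\omega_k\theta(x-t_k)\big)$ is not identically zero. Let $n\ge1$ and $R_{n,k}$ be as in the context. Then, for $k=1,\dots,m$, wherever $R_{n,k}\neq0$, $$\mathcal L^2R_{n,k}-\frac{(\mathcal LR_{n,k})^2}{2R_{n,k}}=R_{n,k}\Bigg[\frac32\Big(\sum_{j=1}^mR_{n,j}\Big)^2-2\sum_{j=1}^m(t_k+t_j)R_{n,j}+2(t_k^2-2n-1)\Bigg],$$ where $\mathcal L=\sum_{k=1}^m\partial/\partial t_k$ and $\mathcal L^2=\mathcal L\circ\mathcal L=\sum_{k=1}^m\frac{\partial^2}{\partial t_k^2}+2\sum_{j<k}\frac{\partial^2}{\partial t_k\partial t_j}$.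
   Context: $\theta(y)=1$ for $y>0$ and $0$ otherwise. $P_n(z;\vec t)$ is the monic degree-$n$ polynomial orthogonal w.r.t. $w(\cdot;\vec t)$ on $\mathbb{R}$, $\int P_jP_kw\,dx=h_k\delta_{jk}$, $h_k>0$. For $k=1,\dots,m$: $R_{n,k}(\vec t):=\omega_k{\rm e}^{-t_k^2}P_n(t_k;\vec t)^2/h_n(\vec t)$. *)

(* Defs.v *)
From HB Require Import structures.
From mathcomp Require Import all_boot all_order all_algebra.
From mathcomp Require Import all_classical all_reals all_analysis.
Set Implicit Arguments. Unset Strict Implicit. Unset Printing Implicit Defensive.
Import Order.TTheory GRing.Theory Num.Theory.
Import numFieldNormedType.Exports.
Local Open Scope classical_set_scope.
Local Open Scope ring_scope.

Definition theta {R : realType} (y : R) : R := if 0 < y then 1 else 0.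

(* The parameter vector t = (t_1,...,t_m) is a row vector t : 'rV[R]_m,
   with t_{k+1} = t 0 k for k : 'I_m.  The weights are omega : nat -> R,
   with omega_0 = omega 0 and omega_{k+1} = omega k.+1. *)
Definition tcoord {R : realType} {m : nat} (t : 'rV[R]_m) (k : 'I_m) : R := t 0 k.

Definition weight {R : realType} {m : nat} (omega : nat -> R) (t : 'rV[R]_m) (x : R) : R :=
  expR (- x ^+ 2) * (omega 0%N + \sum_(k < m) omega k.+1 * theta (x - tcoord t k)).

Definition integralR {R : realType} (f : R -> R) : R :=
  Rintegral (@lebesgue_measure R) setT f.

Definition increasing_params {R : realType} {m : nat} (t : 'rV[R]_m) : Prop :=
  forall i j : 'I_m, (i < j)%N -> tcoord t i < tcoord t j.

Definition monic_OPS {R : realType} {m : nat} (omega : nat -> R)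
    (P : nat -> 'rV[R]_m -> {poly R}) : Prop :=
  forall t : 'rV[R]_m, increasing_params t ->
    (forall j, P j t \is monic /\ size (P j t) = j.+1) /\
    (forall j k, j <> k ->
       integralR (fun x => (P j t).[x] * (P k t).[x] * weight omega t x) = 0).

Definition hnorm {R : realType} {m : nat} (omega : nat -> R)
    (P : nat -> 'rV[R]_m -> {poly R}) (n : nat) (t : 'rV[R]_m) : R :=
  integralR (fun x => (P n t).[x] ^+ 2 * weight omega t x).

Definition Rnk {R : realType} {m : nat} (omega : nat -> R)
    (P : nat -> 'rV[R]_m -> {poly R}) (n : nat) (k : 'I_m) (t : 'rV[R]_m) : R :=
  omega k.+1 * expR (- tcoord t k ^+ 2) * (P n t).[tcoord t k] ^+ 2 / hnorm omega P n t.

Definition evec {R : realType} {m : nat} (k : 'I_m) : 'rV[R]_m :=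
  \row_(j < m) (if j == k then 1 else 0).

Definition partial {R : realType} {m : nat} (k : 'I_m) (f : 'rV[R]_m -> R)
  (t : 'rV[R]_m) : R := 'D_(evec k) f t.

Definition Lop {R : realType} {m : nat} (f : 'rV[R]_m -> R) : 'rV[R]_m -> R :=
  fun t => \sum_(k < m) partial k f t.

(* Main.v *)
Require Import Defs.
From HB Require Import structures.
From mathcomp Require Import all_boot all_order all_algebra.
From mathcomp Require Import all_classical all_reals all_analysis.
From mathcomp Require Import measurable_realfun ring lra.
Set Implicit Arguments. Unset Strict Implicit. Unset Printing Implicit Defensive.
Import Order.TTheory GRing.Theory Num.Theory.
Import numFieldNormedType.Exports.
Local Open Scope classical_set_scope.
Local Open Scope ring_scope.

(** Translating x and all the t_k simultaneously by s multiplies the weight by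
    exp(- 2 s x - s^2), so along L the polynomials evolve by a Toda flow. With
    D = d/dx + L, h_n the squared norms and a_n, b_n the recurrence
    coefficients, orthogonality gives
      D P_n = 2 b_n P_(n-1) = 2 ((x - a_n) P_n - P_(n+1)),   L h_n = - 2 a_n h_n,
    hence, with r_k = omega_k exp(- t_k^2) P_n(t_k) P_(n-1)(t_k) / h_(n-1) and
    B_n h_n = int x^2 P_n^2 w,
      L R_k = 2 (a_n - t_k) R_k + 4 r_k,
      L^2 R_k - (L R_k)^2 / (2 R_k) = R_k (2 (a_n - t_k)^2 - 4 (B_n - a_n^2)).
    Integrating (P_n^2 w)' and (x P_n^2 w)' by parts yields
      2 a_n = sum_j R_j  and  2 B_n = 2 n + 1 + sum_j t_j R_j,
    and substituting gives the bracket. All integrals are linear combinations of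
    moments, i.e. of Gaussian tails that are functions of a single t_k. *)

(** * Gaussian moments and their tails *)

Section GaussianMoments.
Context {R : realType}.
Local Notation mu := (@lebesgue_measure R).

Definition gauss_mon (i : nat) (x : R) : R := x ^+ i * expR (- x ^+ 2).

Lemma continuous_gauss_mon i : continuous (gauss_mon i).
Proof.
move=> x; apply: cvgM; first exact: exprn_continuous.
apply: continuous_comp; last exact: continuous_expR.
by apply: cvgN; exact: exprn_continuous.
Qed.

Lemma measurable_gauss_mon i : measurable_fun setT (gauss_mon i).
Proof. by apply: continuous_measurable_fun; exact: continuous_gauss_mon. Qed.

(** Half of the Gaussian absorbs the power: with u = x^2 / (2 (i+1)), exp(x^2 / 2) is the (i+1)-st
    power of exp(u), while |x|^i <= (1 + x^2)^(i+1) and 1 + x^2 <= 2 (i+1) exp(u). *)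
Lemma gauss_mon_le i (x : R) :
  `|gauss_mon i x| <= (2 * i.+1%:R) ^+ i.+1 * expR (- x ^+ 2 / 2).
Proof.
have i0 : 0 < i.+1%:R :> R by rewrite ltr0n.
have e0 := expR_gt0 (- x ^+ 2 / 2).
have -> : gauss_mon i x = (x ^+ i * expR (- x ^+ 2 / 2)) * expR (- x ^+ 2 / 2).
  by rewrite /gauss_mon -mulrA -expRD; congr (_ * expR _); field.
rewrite normrM (gtr0_norm e0) ler_wpM2r ?(ltW e0)// normrM (gtr0_norm e0).
rewrite mulNr expRN.
rewrite ler_pdivrMr ?expR_gt0//.
set u := x ^+ 2 / (2 * i.+1%:R).
have u0 : 0 <= u by rewrite divr_ge0 ?sqr_ge0// mulr_ge0 ?ltW.
have -> : x ^+ 2 / 2 = i.+1%:R * u by rewrite /u; field; rewrite addrC natr1 gt_eqF.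
rewrite expRM_natl -exprMn.
have h1 : 1 + x ^+ 2 <= 2 * i.+1%:R * expR u.
  apply: (@le_trans _ _ (2 * i.+1%:R * (1 + u))); last first.
    by rewrite ler_wpM2l ?expR_ge1Dx// mulr_ge0 ?ltW.
  rewrite mulrDr mulr1 /u mulrCA divff ?mulr1 ?lerD2r ?mulf_neq0 ?gt_eqF//.
  by rewrite -natr1; have : 0 <= i%:R :> R by []; lra.
have x1 : `|x| <= 1 + x ^+ 2 by rewrite ler_norml; apply/andP; split; nra.
have x2 : 1 <= 1 + x ^+ 2 by rewrite lerDl sqr_ge0.
rewrite normrX (@le_trans _ _ ((1 + x ^+ 2) ^+ i))//.
  by rewrite lerXn2r ?nnegrE// (le_trans _ x2).
apply: (@le_trans _ _ ((1 + x ^+ 2) ^+ i.+1)); first by rewrite ler_weXn2l.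
by rewrite lerXn2r ?nnegrE ?(le_trans _ x2)// (le_trans _ h1)// (le_trans _ x2).
Qed.

Lemma integrable_gauss_mon i : mu.-integrable setT (EFin \o gauss_mon i).
Proof.
(* Division by the peak makes [c] times the standard normal density equal to the bound of
   [gauss_mon_le]. *)
pose c := (2 * i.+1%:R) ^+ i.+1 / normal_peak (1 : R).
apply: (@le_integrable _ _ _ mu setT measurableT _
    (fun x => c%:E * (normal_pdf 0 1 x)%:E)%E).
- by apply/measurable_EFinP; exact: measurable_gauss_mon.
- move=> x _ /=; rewrite lee_fin (le_trans (gauss_mon_le i x))//.
  have p0 : normal_peak (1 : R) != 0 by rewrite gt_eqF// normal_peak_gt0.
  rewrite normal_pdfE// /normal_fun /c subr0 expr1n mulrA divfK//.
  exact: ler_norm.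
- by apply: integrableZl => //; apply: integrable_normal_pdf; rewrite oner_eq0.
Qed.

Definition gauss_full (i : nat) : R := integralR (gauss_mon i).
Definition gauss_tail (i : nat) (y : R) : R :=
  integralR (fun x => gauss_mon i x * theta (x - y)).

Lemma theta_indic (y : R) : (fun x => theta (x - y)) = \1_(`]y, +oo[%classic).
Proof.
apply/funext => x; rewrite /theta indicE subr_gt0.
case: ltP => h; first by rewrite mem_set//= in_itv/= h.
by rewrite memNset//= in_itv/= andbT ltNge h.
Qed.

Lemma gauss_mon_theta i (y : R) :
  (fun x => gauss_mon i x * theta (x - y)) = gauss_mon i \_ (`]y, +oo[%classic).
Proof. by rewrite patch_indic -theta_indic. Qed.

Lemma integrable_gauss_theta i (y : R) :
  mu.-integrable setT (EFin \o (fun x => gauss_mon i x * theta (x - y))).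
Proof.
rewrite gauss_mon_theta -restrict_EFin.
apply: (iffLR (integrable_mkcond _ _)) => //.
apply: integrableS (integrable_gauss_mon i) => //.
Qed.

(** Puts y at the upper end of an integral over a left ray, where the fundamental theorem of
    calculus differentiates it. *)
Lemma gauss_tailE i (y : R) :
  gauss_tail i y = gauss_full i - Rintegral mu `]-oo, y] (gauss_mon i).
Proof.
rewrite /gauss_tail gauss_mon_theta /integralR -Rintegral_mkcond.
apply/eqP; rewrite eq_sym subr_eq addrC; apply/eqP; rewrite /gauss_full /integralR.
have -> : [set: R] = `]-oo, y] `|` `]y, +oo[.
  apply/seteqP; split => // x _ /=; rewrite !in_itv/= andbT.
  by case: leP; [left|right].
rewrite Rintegral_setU//.
  apply: integrableS (integrable_gauss_mon i) => //; exact: measurableU.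
rewrite disj_set2E; apply/eqP/seteqP; split => // x [] /=.
by rewrite !in_itv/= andbT leNgt => /negP.
Qed.

Lemma is_derive_gauss_tail i (y : R) :
  is_derive y 1 (gauss_tail i) (- gauss_mon i y).
Proof.
have -> : gauss_tail i = cst (gauss_full i)
    - (fun y => Rintegral mu [set` Interval -oo%O (BRight y)] (gauss_mon i)).
  by apply/funext => z; rewrite gauss_tailE.
rewrite -[- gauss_mon i y]add0r; apply: is_deriveB.
have [||||d1 d2] := @continuous_FTC1 R (gauss_mon i) -oo%O y (y + 1).
- by rewrite ltrDl.
- exact: integrableS (integrable_gauss_mon i).
- by rewrite ltNyr.
- exact: continuous_gauss_mon.
by apply: DeriveDef => //; rewrite -derive1E.
Qed.

Lemma is_derive_exprn (i : nat) (y : R) :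
  is_derive y 1 (fun x : R => x ^+ i) (i%:R * y ^+ i.-1).
Proof.
by apply: DeriveDef; [exact: exprn_derivable|rewrite exp_derive /GRing.scale/= mulr1].
Qed.

Lemma is_derive_gauss (y : R) :
  is_derive y 1 (fun x : R => expR (- x ^+ 2)) (- (2 * y) * expR (- y ^+ 2)).
Proof. by apply: is_derive_eq; rewrite /GRing.scale/=; ring. Qed.

Lemma is_derive_gauss_mon i (y : R) :
  is_derive y 1 (gauss_mon i) (i%:R * gauss_mon i.-1 y - 2 * gauss_mon i.+1 y).
Proof.
have h1 := is_derive_gauss y; have h2 := is_derive_exprn i y.
have -> : gauss_mon i = (fun x => x ^+ i) * (fun x : R => expR (- x ^+ 2)).
  by apply/funext.
apply: is_derive_eq; rewrite /GRing.scale/= /gauss_mon (exprS y i); ring.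
Qed.


(** * Limits at infinity and integration by parts *)

Lemma cvg_integralR (f_ : nat -> R -> R) (f g : R -> R) :
  (forall n, measurable_fun setT (f_ n)) -> measurable_fun setT f ->
  (forall x, f_ n x @[n --> \oo] --> f x) -> mu.-integrable setT (EFin \o g) ->
  (forall n x, `|f_ n x| <= g x) ->
  integralR (f_ n) @[n --> \oo] --> integralR f.
Proof.
move=> mf_ mf ff ig fg; rewrite /integralR /Rintegral.
have [|||||h1 _ h2] := @dominated_convergence _ _ R mu setT measurableT
  (fun n => EFin \o f_ n) (EFin \o f) (EFin \o g).
- by move=> n; apply/measurable_EFinP; exact: mf_.
- by apply/measurable_EFinP; exact: mf.
- by apply: aeW => x _; apply: cvg_EFin; [exact: nearW|exact: ff].
- exact: ig.
- by apply: aeW => x n _ /=; rewrite lee_fin.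
have -> : (fun n => fine (\int[mu]_x (f_ n x)%:E))
  = fine \o (fun n => \int[mu]_x (f_ n x)%:E)%E by [].
apply: fine_cvg; rewrite fineK; first exact: h2.
exact: integrable_fin_num.
Qed.

Lemma measurable_gauss_theta i (y : R) :
  measurable_fun setT (fun x => gauss_mon i x * theta (x - y)).
Proof. by have /measurable_int/measurable_EFinP := integrable_gauss_theta i y. Qed.

Lemma gauss_theta_le i (y x : R) : `|gauss_mon i x * theta (x - y)| <= `|gauss_mon i x|.
Proof.
by rewrite normrM /theta; case: ifP => _; rewrite ?normr1 ?mulr1// normr0 mulr0.
Qed.

Lemma integrable_norm_gauss_mon i : mu.-integrable setT (EFin \o (Num.norm \o gauss_mon i)).
Proof. exact: integrable_norm (integrable_gauss_mon i). Qed.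

(** Dominated convergence: at a fixed x the step factor vanishes as soon as n >= x. *)
Lemma cvg_gauss_tail_y (i : nat) :
  gauss_tail i n.+1%:R @[n --> \oo] --> (0 : R).
Proof.
have -> : 0 = integralR (cst 0 : R -> R) by rewrite /integralR Rintegral_cst// mul0r.
apply: (cvg_integralR (f_ := fun n x => gauss_mon i x * theta (x - n.+1%:R))
  (g := Num.norm \o gauss_mon i)) => //.
- by move=> n; exact: measurable_gauss_theta.
- move=> x; apply: cvg_near_cst; near=> n; rewrite /theta ifF ?mulr0//.
  apply/negbTE; rewrite -leNgt subr_le0 -natr1 ler_wpDr//.
  by near: n; exact: nbhs_infty_ger.
- exact: integrable_norm_gauss_mon.
- by move=> n x; exact: gauss_theta_le.
Unshelve. all: by end_near. Qed.

Lemma cvg_gauss_tail_Ny (i : nat) :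
  gauss_tail i (- n.+1%:R) @[n --> \oo] --> (gauss_full i : R).
Proof.
apply: (cvg_integralR (f_ := fun n x => gauss_mon i x * theta (x - - n.+1%:R))
  (g := Num.norm \o gauss_mon i)) => //.
- by move=> n; exact: measurable_gauss_theta.
- exact: measurable_gauss_mon.
- move=> x; apply: cvg_near_cst; near=> n; rewrite /theta ifT ?mulr1//.
  rewrite opprK -ltrBlDr sub0r ltrNl -natr1 ltr_wpDr//.
  by near: n; exact: nbhs_infty_gtr.
- exact: integrable_norm_gauss_mon.
- by move=> n x; exact: gauss_theta_le.
Unshelve. all: by end_near. Qed.

(** Multiplying by one more [u n] still leaves a bounded quantity, so the value is at most C /
    (n+1). Only |u n| enters, which serves both ends of the line. *)
Lemma cvg_gauss_mon (i : nat) (u : nat -> R) :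
  (forall n, `|u n| = n.+1%:R) -> gauss_mon i (u n) @[n --> \oo] --> (0 : R).
Proof.
move=> un; pose C : R := (2 * i.+2%:R) ^+ i.+2.
apply: norm_cvg0.
apply: (@squeeze_cvgr _ _ _ _ (cst 0) (fun n => C * n.+1%:R^-1)).
- near=> n; rewrite normr_ge0/= ler_pdivlMr// -un -normrM.
  have -> : gauss_mon i (u n) * u n = gauss_mon i.+1 (u n).
    by rewrite /gauss_mon (exprSr _ i); ring.
  rewrite (le_trans (gauss_mon_le _ _))// ler_piMr ?exprn_ge0//.
  by rewrite -expR0 ler_expR mulNr oppr_le0 divr_ge0// sqr_ge0.
- exact: cvg_cst.
- rewrite -(mulr0 C); apply: cvgM; [exact: cvg_cst|exact: cvg_harmonic].
Unshelve. all: by end_near. Qed.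

(** The integral of (x^i exp(-x^2))' over the ray above y, plus the boundary term at y. At i = 0 the
    truncated index [i.-1] comes with the factor 0. *)
Let parts i (y : R) : R :=
  i%:R * gauss_tail i.-1 y - 2 * gauss_tail i.+1 y + gauss_mon i y.

Lemma parts_cst i (x y : R) : parts i x = parts i y.
Proof.
apply: is_derive_0_is_cst => z.
have h1 := is_derive_gauss_tail i.-1 z.
have h2 := is_derive_gauss_tail i.+1 z.
have h3 := is_derive_gauss_mon i z.
rewrite (_ : parts i = cst i%:R * gauss_tail i.-1 - cst 2 * gauss_tail i.+1 + gauss_mon i)//.
apply: is_derive_eq; rewrite /GRing.scale/=; ring.
Qed.

(** The constant value of [parts i] is its limit at +oo, where the tails and the boundary term tend
    to 0. *)
Lemma gauss_tail_parts i (y : R) :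
  i%:R * gauss_tail i.-1 y - 2 * gauss_tail i.+1 y + gauss_mon i y = 0.
Proof.
have h : parts i n.+1%:R @[n --> \oo] --> (i%:R * 0 - 2 * 0 + 0 : R).
  apply: cvgD; last by apply: cvg_gauss_mon => n; rewrite ger0_norm.
  apply: cvgB; (apply: cvgM; first exact: cvg_cst); exact: cvg_gauss_tail_y.
rewrite !mulr0 subr0 addr0 in h.
have := h; under eq_fun do rewrite (parts_cst _ _ y).
by move=> /(cvg_unique _ (cvg_cst _)); apply.
Qed.

(** The same constant, read off at -oo, where the tails fill up to the full integrals. *)
Lemma gauss_full_parts i : i%:R * gauss_full i.-1 - 2 * gauss_full i.+1 = 0 :> R.
Proof.
have h : parts i (- n.+1%:R) @[n --> \oo] --> (i%:R * gauss_full i.-1 - 2 * gauss_full i.+1 + 0 : R).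
  apply: cvgD; last by apply: cvg_gauss_mon => n; rewrite normrN ger0_norm.
  apply: cvgB; (apply: cvgM; first exact: cvg_cst); exact: cvg_gauss_tail_Ny.
rewrite addr0 in h; have := h; under eq_fun do rewrite (parts_cst _ _ 0).
rewrite {1}/parts gauss_tail_parts.
by move=> /(cvg_unique _ (cvg_cst _)) e; apply/esym/e.
Qed.

End GaussianMoments.

(** * Differentiation along L *)

(* Unification may unfold [nbhs] at a matrix before instance resolution sees
   it; these versions of the filter lemmas pin the filter down. *)
Section NearRow.
Context {R : realType} {m : nat}.
Implicit Types (t : 'rV[R]_m) (P Q S : 'rV[R]_m -> Prop).

Lemma near_row_all t P : (forall s, P s) -> \forall s \near t, P s.
Proof. by move=> h; exact: (@nearW _ (nbhs t) P). Qed.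

Lemma near_row_mono t P Q :
  (forall s, P s -> Q s) -> (\forall s \near t, P s) -> \forall s \near t, Q s.
Proof. exact: (@filterS _ (nbhs t)). Qed.

Lemma near_row_mono2 t P Q S : (forall s, P s -> Q s -> S s) ->
  (\forall s \near t, P s) -> (\forall s \near t, Q s) -> \forall s \near t, S s.
Proof. exact: (@filterS2 _ (nbhs t)). Qed.

Lemma near_row_forall t (I : finType) (Q : I -> 'rV[R]_m -> Prop) :
  (forall i, \forall s \near t, Q i s) -> \forall s \near t, forall i, Q i s.
Proof. exact: (@filter_forall _ _ Q (nbhs t)). Qed.

End NearRow.

Section TotalDerivative.
Context {R : realType} {m : nat}.
Implicit Types (f g : 'rV[R]_m -> R) (t : 'rV[R]_m).

(* [Lop] is a sum of partial derivatives, so the calculus below only needs the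
   partial derivatives to exist, not Frechet differentiability. *)
Definition hasL f t (d : R) : Prop :=
  (forall j, derivable f t (evec j)) /\ Lop f t = d.

Lemma hasL_eq f t d d' : hasL f t d -> d = d' -> hasL f t d'.
Proof. by move=> h <-. Qed.

Lemma hasL_inj f t d d' : hasL f t d -> hasL f t d' -> d = d'.
Proof. by move=> [_ <-] []. Qed.

(** Partial derivatives at t see only the germ at t. Identities valid for increasing parameters, an
    open condition by [near_increasing], can therefore be differentiated. *)
Lemma hasL_near f g t d : (\forall s \near t, f s = g s) -> hasL f t d -> hasL g t d.
Proof.
move=> fg [df <-]; split=> [j|]; first exact: near_eq_derivable (df j).
by apply: eq_bigr => k _; apply: near_eq_derive; near do apply/esym.
Unshelve. all: by end_near. Qed.

Lemma hasL_cst c t : hasL (fun=> c) t 0.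
Proof.
by split=> [j|]; [exact: derivable_cst|apply: big1 => k _; exact: derive_cst].
Qed.

Lemma hasL_add f g t df dg :
  hasL f t df -> hasL g t dg -> hasL (fun s => f s + g s) t (df + dg).
Proof.
move=> [f1 <-] [g1 <-]; split=> [j|]; first exact: derivableD.
by rewrite /Lop -big_split; apply: eq_bigr => k _; exact: deriveD.
Qed.

Lemma hasL_mul f g t df dg :
  hasL f t df -> hasL g t dg -> hasL (fun s => f s * g s) t (f t * dg + g t * df).
Proof.
move=> [f1 <-] [g1 <-]; split=> [j|]; first exact: derivableM.
by rewrite /Lop !mulr_sumr -big_split; apply: eq_bigr => k _; exact: deriveM.
Qed.

Lemma hasL_scale c f t df : hasL f t df -> hasL (fun s => c * f s) t (c * df).
Proof.
by move=> h; apply: hasL_eq (hasL_mul (hasL_cst c t) h) _; rewrite mulr0 addr0.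
Qed.

Lemma hasL_opp f t df : hasL f t df -> hasL (fun s => - f s) t (- df).
Proof.
move=> h; have := hasL_scale (-1) h; rewrite mulN1r.
by under eq_fun do rewrite mulN1r.
Qed.

Lemma hasL_sub f g t df dg :
  hasL f t df -> hasL g t dg -> hasL (fun s => f s - g s) t (df - dg).
Proof. by move=> h1 h2; apply: hasL_add h1 (hasL_opp h2). Qed.

Lemma hasL_sum (I : Type) (r : seq I) (f d : I -> _) t :
  (forall i, hasL (f i) t (d i)) ->
  hasL (fun s => \sum_(i <- r) f i s) t (\sum_(i <- r) d i).
Proof.
move=> h; elim: r => [|i r IH].
  by rewrite big_nil; under eq_fun do rewrite big_nil; exact: hasL_cst.
by rewrite big_cons; under eq_fun do rewrite big_cons; exact: hasL_add.
Qed.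

Lemma hasL_inv f t df : f t != 0 ->
  hasL f t df -> hasL (fun s => (f s)^-1) t (- df / f t ^+ 2).
Proof.
move=> f0 [f1 <-]; split=> [j|]; first exact: derivableV.
rewrite mulNr -mulrN mulrC mulr_sumr; apply: eq_bigr => k _.
by rewrite /partial deriveV//.
Qed.

(** Along v the k-th coordinate moves with speed [v 0 k], so the two difference quotients are the
    same function of the increment. *)
Lemma is_derive_coord (F : R -> R) (k : 'I_m) t (v : 'rV[R]_m) (d : R) :
  is_derive (t 0 k) (v 0 k) F d -> is_derive t v (fun s => F (s 0 k)) d.
Proof.
move=> [h1 h2].
have e : (fun h => h^-1 *: (((fun s : 'rV[R]_m => F (s 0 k)) \o shift t) (h *: v) - F (t 0 k)))
   = (fun h => h^-1 *: ((F \o shift (t 0 k)) (h *: (v 0 k)) - F (t 0 k))).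
  by apply/funext => h /=; rewrite !mxE.
by split; rewrite /derivable /derive e.
Qed.

Lemma hasL_coord (F : R -> R) (k : 'I_m) t (d : R) :
  is_derive (t 0 k) 1 F d -> hasL (fun s => F (s 0 k)) t d.
Proof.
move=> h.
(* In the directions other than [evec k] the coordinate k is at rest. *)
have hj j : is_derive t (evec j) (fun s => F (s 0 k)) (if k == j then d else 0).
  apply: is_derive_coord; rewrite mxE; case: eqVneq => // _.
  by split; [exact: derivable0|exact: derive0].
split=> [j|]; first by have [] := hj j.
rewrite /Lop (bigD1 k)//= big1 ?addr0; last first.
  by move=> i /negbTE ik; have [_] := hj i; rewrite eq_sym ik.
by have [_] := hj k; rewrite eqxx.
Qed.

Lemma near_increasing t : increasing_params t -> \forall s \near t, increasing_params s.
Proof.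
move=> it.
(* Indexing the inequalities by the finite type of pairs leaves finitely many neighbourhoods to
   intersect. *)
suff h : \forall s \near t, forall ij : 'I_m * 'I_m, (ij.1 < ij.2)%N -> tcoord s ij.1 < tcoord s ij.2.
  by apply: near_row_mono h => s hs i j; exact: (hs (i, j)).
pose Q (ij : 'I_m * 'I_m) (s : 'rV[R]_m) := (ij.1 < ij.2)%N -> tcoord s ij.1 < tcoord s ij.2.
apply: (@near_row_forall _ _ _ _ Q) => -[i j]; rewrite /Q /=.
have [ij|_] := ltnP i j; last exact: near_row_all.
have c : {for t, continuous (fun s : 'rV[R]_m => s 0 j - s 0 i)}.
  exact: (differentiable_continuous
    (differentiableB (differentiable_coord t 0 j) (differentiable_coord t 0 i))).
have := it i j ij; rewrite -subr_gt0 => p.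
have h : \forall s \near t, 0 < (s : 'rV[R]_m) 0 j - s 0 i by exact: (@cvgr_gt _ _ (nbhs t) _ _ _ c _ p).
by apply: near_row_mono h => s; rewrite subr_gt0.
Qed.

End TotalDerivative.

(** * Differentiating families of polynomials *)

Section PolyFamilies.
Context {R : realType} {m : nat}.
Implicit Types (p q : 'rV[R]_m -> {poly R}) (t : 'rV[R]_m).

(** The size bound, uniform near t, turns evaluations and moments of the family into sums of one
    fixed finite length. *)
Definition hasLp p t (dp : {poly R}) : Prop :=
  (exists N, \forall s \near t, (size (p s) <= N)%N) /\
  forall i, hasL (fun s => (p s)`_i) t dp`_i.

Lemma hasLp_eq p t d d' : hasLp p t d -> d = d' -> hasLp p t d'.
Proof. by move=> h <-. Qed.

Lemma hasLp_near p q t d : (\forall s \near t, p s = q s) -> hasLp p t d -> hasLp q t d.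
Proof.
move=> pq [[N hN] h]; split.
  by exists N; apply: near_row_mono2 pq hN => s ->.
by move=> i; apply: hasL_near (h i); apply: near_row_mono pq => s ->.
Qed.

Lemma hasLp_cst (q : {poly R}) t : hasLp (fun=> q) t 0.
Proof.
by split; [exists (size q); exact: near_row_all|move=> i; rewrite coef0; exact: hasL_cst].
Qed.

Lemma hasLp_add p q t dp dq :
  hasLp p t dp -> hasLp q t dq -> hasLp (fun s => p s + q s) t (dp + dq).
Proof.
move=> [[N hN] hp] [[K hK] hq]; split.
  exists (maxn N K); apply: near_row_mono2 hN hK => s hN hK.
  by rewrite (leq_trans (size_polyD _ _))// geq_max !leq_max hN hK orbT.
by move=> i; rewrite coefD; under eq_fun do rewrite coefD; exact: hasL_add.
Qed.

Lemma hasLp_mul p q t dp dq :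
  hasLp p t dp -> hasLp q t dq -> hasLp (fun s => p s * q s) t (p t * dq + q t * dp).
Proof.
move=> [[N hN] hp] [[K hK] hq]; split.
  exists (N + K)%N; apply: near_row_mono2 hN hK => s hN hK.
  by rewrite (leq_trans (size_polyMleq _ _))// (leq_trans (leq_pred _))// leq_add.
move=> i; under eq_fun do rewrite coefM.
apply: hasL_eq; first by apply: hasL_sum => k; apply: hasL_mul.
by rewrite coefD coefM [q t * dp]mulrC coefM -big_split; apply: eq_bigr => k _; rewrite [X in _ + X]mulrC.
Qed.

Lemma hasLp_const (c : 'rV[R]_m -> R) t dc : hasL c t dc -> hasLp (fun s => (c s)%:P) t dc%:P.
Proof.
move=> h; split; first by exists 1%N; apply: near_row_all => s; exact: size_polyC_leq1.
by move=> [|i]; rewrite coefC/=; under eq_fun do rewrite coefC/=; [|exact: hasL_cst].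
Qed.

Lemma hasLp_scale (c : 'rV[R]_m -> R) p t dc dp :
  hasL c t dc -> hasLp p t dp -> hasLp (fun s => c s *: p s) t (c t *: dp + dc *: p t).
Proof.
move=> hc hp; have := hasLp_mul (hasLp_const hc) hp.
rewrite [p t * _]mulrC !mul_polyC.
by under eq_fun do rewrite mul_polyC.
Qed.

Lemma hasLp_sum (I : Type) (r : seq I) (p : I -> _) (d : I -> _) t :
  (forall i, hasLp (p i) t (d i)) ->
  hasLp (fun s => \sum_(i <- r) p i s) t (\sum_(i <- r) d i).
Proof.
move=> h; elim: r => [|i r IH].
  by rewrite big_nil; under eq_fun do rewrite big_nil; exact: hasLp_cst.
by rewrite big_cons; under eq_fun do rewrite big_cons; exact: hasLp_add.
Qed.

Lemma poly_def_wide (p : {poly R}) N : (size p <= N)%N -> p = \sum_(i < N) p`_i *: 'X^i.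
Proof.
move=> pN; apply/polyP => i; rewrite -poly_def coef_poly; case: ltnP => // h.
by rewrite nth_default// (leq_trans pN).
Qed.

(** L moves the evaluation point t_k at unit speed, which adds p' to the derivative of the
    coefficients. *)
Lemma hasLp_horner p t dp (k : 'I_m) : hasLp p t dp ->
  hasL (fun s => (p s).[s 0 k]) t (dp + (p t)^`()).[t 0 k].
Proof.
move=> [[N hN] hp].
pose N' := maxn N (size dp).
have hN' : \forall s \near t, (size (p s) <= N')%N.
  by apply: near_row_mono hN => s h; rewrite leq_max h.
apply: (@hasL_near _ _ (fun s => \sum_(i < N') (p s)`_i * (s 0 k) ^+ i)).
  by apply: near_row_mono hN' => s h; rewrite (@horner_coef_wide _ N').
apply: hasL_eq.
  apply: hasL_sum => i; apply: hasL_mul; first exact: hp.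
  exact: (hasL_coord (is_derive_exprn i _)).
rewrite big_split/= hornerD addrC (@horner_coef_wide _ N') ?leq_maxr//; congr (_ + _).
  by apply: eq_bigr => i _; rewrite mulrC.
rewrite [in RHS](@poly_def_wide (p t) N') ?(nbhs_singleton hN')//.
rewrite raddf_sum horner_sum; apply: eq_bigr => i _ /=.
by rewrite derivZ derivXn hornerZ hornerMn hornerXn mulr_natl.
Qed.

End PolyFamilies.

(** * The moment functional *)

Section MomentFunctional.
Context {R : realType} {m : nat} (omega : nat -> R).
Implicit Types (t : 'rV[R]_m) (p q : {poly R}).
Local Notation mu := (@lebesgue_measure R).

(** Written through Gaussian tails, so that each summand depends on a single t_k and is
    differentiable; [integralR_poly_weight] makes the link with the weight. *)
Definition moment t (i : nat) : R :=
  omega 0%N * gauss_full i + \sum_(k < m) omega k.+1 * gauss_tail i (tcoord t k).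

Definition mom t p : R := \sum_(i < size p) p`_i * moment t i.

(** The jump that the k-th step gives the weight at t_k. *)
Definition jump t (k : 'I_m) : R := omega k.+1 * expR (- tcoord t k ^+ 2).

Lemma mom_wide t p N : (size p <= N)%N -> mom t p = \sum_(i < N) p`_i * moment t i.
Proof.
move=> pN; rewrite /mom (big_ord_widen N (fun i => p`_i * moment t i))// big_mkcond.
by apply: eq_bigr => i _; case: ltnP => // h; rewrite nth_default ?mul0r.
Qed.

Fact mom_is_linear t : linear_for *%R (mom t).
Proof.
move=> c p q; pose N := maxn (size (c *: p + q)) (maxn (size p) (size q)).
rewrite (@mom_wide _ (c *: p + q) N) ?leq_maxl//.
rewrite (@mom_wide _ p N) ?leq_max ?leqnn ?orbT//.
rewrite (@mom_wide _ q N) ?leq_max ?leqnn ?orbT//.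
rewrite mulr_sumr -big_split; apply: eq_bigr => i _ /=.
by rewrite coefD coefZ; ring.
Qed.
HB.instance Definition _ t := GRing.isLinear.Build R {poly R} R *%R (mom t) (mom_is_linear t).

Lemma momZ t c p : mom t (c *: p) = c * mom t p.
Proof. exact: linearZ. Qed.

Lemma momD t p q : mom t (p + q) = mom t p + mom t q.
Proof. exact: raddfD. Qed.

Lemma momN t p : mom t (- p) = - mom t p.
Proof. exact: raddfN. Qed.

Lemma momB t p q : mom t (p - q) = mom t p - mom t q.
Proof. exact: raddfB. Qed.

Lemma mom_sum t (I : Type) (r : seq I) (p : I -> {poly R}) :
  mom t (\sum_(i <- r) p i) = \sum_(i <- r) mom t (p i).
Proof. exact: raddf_sum. Qed.

Lemma mom_exp t i : mom t 'X^i = moment t i.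
Proof.
rewrite (@mom_wide _ _ i.+1) ?size_polyXn// big_ord_recr/= big1 ?add0r.
  by rewrite coefXn eqxx mul1r.
by move=> k _; rewrite coefXn ltn_eqF ?mul0r.
Qed.

(** The integral of (p w)' vanishes, where w' is - 2 x w plus point masses [jump t k] at the nodes.
    By linearity it suffices to treat monomials. *)
Lemma mom_parts t p :
  mom t p^`() - 2 * mom t ('X * p) + \sum_(k < m) jump t k * p.[tcoord t k] = 0.
Proof.
rewrite (@poly_def_wide _ p (size p))//.
under [X in _ + X]eq_bigr do rewrite horner_sum mulr_sumr.
rewrite exchange_big ['X * _]mulr_sumr (raddf_sum (@deriv R)) !mom_sum mulr_sumr -sumrB -big_split/=.
apply: big1 => i _.
rewrite derivZ derivXn -scalerAr -exprS !momZ raddfMn/= !mom_exp.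
have e : i%:R * moment t i.-1 - 2 * moment t i.+1 + \sum_(k < m) jump t k * tcoord t k ^+ i = 0.
  rewrite /moment !mulrDr !mulr_sumr.
  (* Each step term has its boundary term at its own node; the constant part of the weight has
     none. *)
  have -> : \sum_(k < m) jump t k * tcoord t k ^+ i
     = \sum_(k < m) (2 * (omega k.+1 * gauss_tail i.+1 (tcoord t k))
        - i%:R * (omega k.+1 * gauss_tail i.-1 (tcoord t k))).
    apply: eq_bigr => k _; have := gauss_tail_parts i (tcoord t k).
    rewrite /gauss_mon /jump => h; apply/eqP; rewrite -subr_eq0; apply/eqP.
    by rewrite -[RHS](mulr0 (omega k.+1)) -[in RHS]h; ring.
  rewrite sumrB.
  have := gauss_full_parts (R := R) i => h.
  transitivity (omega 0%N * (i%:R * gauss_full i.-1 - 2 * gauss_full i.+1)); first ring.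
  by rewrite h mulr0.
under eq_bigr do rewrite hornerZ hornerXn mulrCA.
rewrite -mulr_sumr -(mulr_natl (moment _ _)).
by have := congr1 (fun z => p`_i * z) e; rewrite mulr0 /= => h; apply: etrans h; ring.
Qed.

Lemma hasL_moment t i : hasL (fun s => moment s i) t (- \sum_(k < m) jump t k * tcoord t k ^+ i).
Proof.
apply: hasL_eq.
  apply: hasL_add; first exact: hasL_cst.
  apply: hasL_sum => k; apply: hasL_scale.
  exact: (hasL_coord (is_derive_gauss_tail i _)).
rewrite add0r -sumrN; apply: eq_bigr => k _.
by rewrite /jump /gauss_mon /tcoord; ring.
Qed.

Lemma hasL_jump t k : hasL (fun s => jump s k) t (- 2 * tcoord t k * jump t k).
Proof.
apply: hasL_eq; first exact: hasL_scale (hasL_coord (is_derive_gauss (t 0 k))).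
by rewrite /jump /tcoord; ring.
Qed.

(* [dp + p'] is the derivative of the family along the flow translating the
   variable and all the [t_k] simultaneously; this flow multiplies the weight
   by a Gaussian factor only. *)
Lemma hasL_mom (p : 'rV[R]_m -> {poly R}) t dp : hasLp p t dp ->
  hasL (fun s => mom s (p s)) t (mom t (dp + (p t)^`() - 2 *: ('X * p t))).
Proof.
move=> [[N hN] hp].
pose N' := maxn N (size dp).
have hN' : \forall s \near t, (size (p s) <= N')%N.
  by apply: near_row_mono hN => s h; rewrite leq_max h.
apply: (@hasL_near _ _ (fun s => \sum_(i < N') (p s)`_i * moment s i)).
  by apply: near_row_mono hN' => s h; rewrite (@mom_wide _ _ N').
apply: hasL_eq.
  by apply: hasL_sum => i; apply: hasL_mul; [exact: hp|exact: hasL_moment].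
(* Varying the coefficients gives [mom t dp]. Varying the moments gives minus the sum of the jumps
   times the values of p at the nodes, which [mom_parts] turns into the other two terms. *)
have := mom_parts t (p t).
rewrite momB momD momZ -[mom t dp + _ - _]addrA => /eqP; rewrite addr_eq0 => /eqP ->.
rewrite big_split/= addrC (@mom_wide _ dp N') ?leq_maxr//; congr (_ + _).
  by apply: eq_bigr => i _; rewrite mulrC.
under eq_bigr do rewrite mulrN mulr_sumr.
rewrite sumrN exchange_big/=; congr (- _); apply: eq_bigr => k _.
rewrite (@horner_coef_wide _ N') ?(nbhs_singleton hN')// mulr_sumr.
by apply: eq_bigr => i _; rewrite mulrCA.
Qed.

(** * The moment functional as an integral against the weight *)

Lemma weight_mon t i : (fun x => x ^+ i * weight omega t x) = (fun x =>
  omega 0%N * gauss_mon i x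
   + \sum_(k < m) omega k.+1 * (gauss_mon i x * theta (x - tcoord t k))).
Proof.
apply/funext => x; rewrite /weight /gauss_mon mulrA mulrDr mulr_sumr mulrC.
by congr (_ + _); apply: eq_bigr => k _; rewrite mulrCA.
Qed.

Let intg f := mu.-integrable setT (EFin \o f).

Let intgD f g : intg f -> intg g -> intg (fun x => f x + g x).
Proof.
by move=> h1 h2; exact: (integrableD measurableT h1 h2).
Qed.

Let intgZ c f : intg f -> intg (fun x => c * f x).
Proof.
by move=> h1; exact: (integrableZl measurableT c h1).
Qed.

Let integralRZ c f : intg f -> integralR (fun x => c * f x) = c * integralR f.
Proof. exact: RintegralZl. Qed.

Let intg_sum n (f : 'I_n -> R -> R) : (forall i, intg (f i)) ->
  intg (fun x => \sum_(i < n) f i x) /\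
  integralR (fun x => \sum_(i < n) f i x) = \sum_(i < n) integralR (f i).
Proof.
move=> h; elim: (index_enum _) => [|i r [IH1 IH2]].
  rewrite big_nil; under eq_fun do rewrite big_nil.
  by split; [exact: integrable0|rewrite /integralR Rintegral_cst// mul0r].
rewrite big_cons; under eq_fun do rewrite big_cons; split; first exact: intgD.
by rewrite -IH2; exact: (RintegralD measurableT (h i) IH1).
Qed.

Let intg_weight t i : intg (fun x => x ^+ i * weight omega t x) /\
  integralR (fun x => x ^+ i * weight omega t x) = moment t i.
Proof.
rewrite weight_mon.
have h (k : 'I_m) : intg (fun x => omega k.+1 * (gauss_mon i x * theta (x - tcoord t k))).
  by apply: intgZ; exact: integrable_gauss_theta.
have [h1] := intg_sum h.
under [in X in _ = X -> _]eq_bigr do rewrite (integralRZ _ (integrable_gauss_theta _ _)).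
move=> h2.
have h0 := intgZ (omega 0%N) (integrable_gauss_mon i).
split; first exact: intgD.
rewrite /integralR (RintegralD measurableT h0 h1) /moment -h2.
by congr (_ + _); exact: (integralRZ _ (integrable_gauss_mon i)).
Qed.

Let intg_poly t p : intg (fun x => p.[x] * weight omega t x) /\
  integralR (fun x => p.[x] * weight omega t x) = mom t p.
Proof.
have -> : (fun x => p.[x] * weight omega t x)
   = (fun x => \sum_(i < size p) p`_i * (x ^+ i * weight omega t x)).
  apply/funext => x; rewrite horner_coef mulr_suml.
  by apply: eq_bigr => i _; rewrite mulrA.
have h i : intg (fun x => p`_i * (x ^+ i * weight omega t x)).
  by apply: intgZ; exact: (intg_weight t i).1.
have [h1 h2] := intg_sum (fun i : 'I_(size p) => h i).
split => //; rewrite h2; apply: eq_bigr => i _.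
have [g1 g2] := intg_weight t i.
by rewrite (integralRZ _ g1) g2.
Qed.

Lemma integrable_poly_weight t p : mu.-integrable setT (EFin \o (fun x => p.[x] * weight omega t x)).
Proof. exact: (intg_poly t p).1. Qed.

Lemma integralR_poly_weight t p : integralR (fun x => p.[x] * weight omega t x) = mom t p.
Proof. exact: (intg_poly t p).2. Qed.

End MomentFunctional.

(** * Positivity of the moment functional on squares *)

Lemma finite_roots (F : fieldType) (p : {poly F}) : p != 0 -> finite_set [set x | root p x].
Proof.
have [n] := ubnP (size p); elim: n p => // n IH p pn p0.
have [[x rx]|nr] := pselect (exists x, root p x); last first.
  by rewrite (_ : [set _ | _] = set0)//; apply/seteqP; split => // x rx; apply: nr; exists x.
have /factor_theorem[q pq] := rx.
have q0 : q != 0 by apply: contraNneq p0 => q0; rewrite pq q0 mul0r.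
apply: (@sub_finite_set _ _ ([set x] `|` [set x | root q x])).
  move=> y /=; rewrite pq rootM root_XsubC => /orP[|/eqP ->]; [by right|by left].
rewrite finite_setU; split; first exact: finite_set1.
apply: IH => //; move: pn; rewrite pq size_Mmonic ?monicXsubC// size_XsubC.
by rewrite addn2/= ltnS.
Qed.

Section Positivity.
Context {R : realType} {m : nat} (omega : nat -> R).
Implicit Types (t : 'rV[R]_m) (x : R) (l : nat).
Local Notation mu := (@lebesgue_measure R).

(** Indexes the constant pieces of the step factor: at such x, for l <= m, it equals omega_0 + ... +
    omega_l. *)
Definition nodes_below t x l := forall k : 'I_m, (tcoord t k < x) = (k < l)%N.

Lemma increasing_params_lt t (i j : 'I_m) : increasing_params t ->
  (tcoord t i < tcoord t j) = (i < j)%N.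
Proof.
move=> it; case: (ltngtP i j) => [ij|ji|/ord_inj ->]; last exact: ltxx.
- exact: it.
- by apply/negbTE; rewrite -leNgt ltW// it.
Qed.

Lemma nodes_below_ex t x : increasing_params t ->
  exists2 l, (l <= m)%N & nodes_below t x l.
Proof.
(* One more than the largest index of a node below x; the empty maximum gives 0 if there is none. *)
move=> it; exists (\max_(k < m | (tcoord t k < x)%R) k.+1)%N.
  by apply/bigmax_leqP => k _; exact: ltn_ord.
move=> k; apply/idP/idP => h.
  exact: (@leq_bigmax_cond _ _ (fun k : 'I_m => k.+1) k h).
apply: contraLR h; rewrite -leNgt -leqNgt => xk.
apply/bigmax_leqP => i ix; rewrite -(increasing_params_lt _ _ it).
exact: lt_le_trans xk.
Qed.

Lemma nodes_below_pt t l : increasing_params t -> (l <= m)%N ->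
  exists x, nodes_below t x l.
Proof.
(* For l < m the node of index l has exactly l nodes strictly below it, indices starting at 0; for l
   = m a point beyond all nodes is taken. *)
move=> it; rewrite leq_eqVlt => /orP[/eqP ->|lm]; last first.
  by exists (tcoord t (Ordinal lm)) => k; rewrite increasing_params_lt.
exists (1 + \big[Num.max/0]_(k < m) tcoord t k) => k.
rewrite ltn_ord ltr_pwDl//.
exact: le_bigmax.
Qed.

(** The interval extends to the left because x may itself be a node, and [theta] is 0 at 0. *)
Lemma nodes_below_itv t x l : nodes_below t x l ->
  exists2 a, a < x & forall y, a < y <= x -> nodes_below t y l.
Proof.
move=> h; exists (\big[Num.max/(x - 1)]_(k < m | tcoord t k < x) tcoord t k).
  by apply: bigmax_lt => //; rewrite ltrBlDr ltrDl.
move=> y /andP[ay yx] k; rewrite -h; apply/idP/idP => ky.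
  exact: lt_le_trans ky yx.
by apply: le_lt_trans ay; exact: le_bigmax_cond.
Qed.

Lemma weight_step t x l : (l <= m)%N -> nodes_below t x l ->
  weight omega t x = expR (- x ^+ 2) * \sum_(k < l.+1) omega k.
Proof.
move=> lm h; rewrite /weight big_ord_recl; congr (_ * (_ + _)).
rewrite (big_ord_widen m (fun k => omega k.+1))// [RHS]big_mkcond.
by apply: eq_bigr => k _; rewrite /theta subr_gt0 h; case: ifP; rewrite ?mulr1 ?mulr0.
Qed.

Hypothesis omega_ge0 : forall l, (l <= m)%N -> 0 <= \sum_(k < l.+1) omega k.

Lemma weight_ge0 t x : increasing_params t -> 0 <= weight omega t x.
Proof.
move=> it; have [l lm h] := nodes_below_ex x it.
by rewrite (weight_step lm h) mulr_ge0 ?expR_ge0 ?omega_ge0.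
Qed.

(** A nonzero value of the weight at t singles out a positive partial sum of the omegas; that sum is
    also the step factor on some interval for s. Nonvanishing thus passes from t to every increasing
    s. *)
Lemma weight_gt0_itv t (s : 'rV[R]_m) : increasing_params t -> increasing_params s ->
  (exists x, weight omega t x != 0) ->
  exists a b, a < b /\ forall x, a < x < b -> 0 < weight omega s x.
Proof.
move=> it is_ [x]; have [l lm h] := nodes_below_ex x it.
rewrite (weight_step lm h) mulf_eq0 negb_or => /andP[_ w0].
have [b hb] := nodes_below_pt is_ lm.
have [a ab ha] := nodes_below_itv hb.
exists a, b; split => // y /andP[ay yb].
rewrite (weight_step lm (ha y _)) ?ay ?ltW//.
by rewrite mulr_gt0 ?expR_gt0// lt_neqAle eq_sym w0 omega_ge0.
Qed.

(** If the integral were 0, the nonnegative integrand would vanish almost everywhere. On ]a, b[ it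
    vanishes only at the finitely many roots of p, so ]a, b[ would be a null set. *)
Lemma mom_sqr_gt0 t (p : {poly R}) : increasing_params t ->
  (exists a b, a < b /\ forall x, a < x < b -> 0 < weight omega t x) ->
  p != 0 -> 0 < mom omega t (p * p).
Proof.
move=> it [a [b [ab wab]]] p0.
pose f x := (p * p).[x] * weight omega t x.
have f0 x : 0 <= f x by rewrite /f hornerM mulr_ge0 ?weight_ge0// -expr2 sqr_ge0.
have fi : mu.-integrable setT (EFin \o f) by exact: integrable_poly_weight.
rewrite -integralR_poly_weight -/f lt_neqAle; apply/andP; split; last first.
  by apply: Rintegral_ge0 => x _; exact: f0.
apply/negP => /eqP e.
have e0 : (\int[mu]_(x in setT) `|(EFin \o f) x| = 0)%E.
  rewrite (_ : (fun x => `|(EFin \o f) x|%E) = EFin \o f); last first.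
    by apply/funext => x /=; rewrite ger0_norm.
  rewrite -(@fineK _ (\int[mu]_x _)%E); last exact: integrable_fin_num.
  by rewrite [fine _](esym e).
have [mf _] := integrableP _ _ _ fi.
have /(ae_eq_integral_abs mu measurableT mf) ae0 := e0.
have n1 : mu.-negligible [set x | f x != 0].
  apply: negligibleS ae0 => x /= fx h; move: fx; have /= [->] := h I.
  by rewrite eqxx.
have n2 : mu.-negligible [set x | root p x].
  exists [set x | root p x]; split => //.
    by apply: countable_measurable => //; apply: finite_set_countable; exact: finite_roots.
  by apply: countable_lebesgue_measure0; apply: finite_set_countable; exact: finite_roots.
have n3 : mu.-negligible `]a, b[%classic.
  apply: negligibleS (negligibleU n1 n2) => x /=; rewrite in_itv/= => xab.
  have [rx|rx] := boolP (root p x); [by right|left].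
  have w0 : weight omega t x != 0 by apply: lt0r_neq0; exact: wab.
  by rewrite /f hornerM; apply: mulf_neq0 w0; apply: mulf_neq0.
have m0 : mu [set` `]a, b[] = 0%E by exact: (iffLR (negligibleP mu (measurable_itv `]a, b[)) n3).
have := lebesgue_measure_itv `]a, b[; rewrite /= m0 lte_fin ab -EFinB => /esym/eqP.
by rewrite eqe subr_eq0 gt_eqF.
Qed.

End Positivity.

(** * The Toda flow of the orthogonal polynomials *)

Section OrthogonalPolynomials.
Context {R : realType} {m : nat} (omega : nat -> R) (P : nat -> 'rV[R]_m -> {poly R}).
Implicit Types (t s : 'rV[R]_m) (p q : {poly R}).

Hypothesis P_OPS : monic_OPS omega P.
Hypothesis mom_pos : forall t p, increasing_params t -> p != 0 -> 0 < mom omega t (p * p).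

Local Notation M := (mom omega).

Definition sqnorm n t : R := M t (P n t * P n t).
(** The recurrence coefficient a_n. *)
Definition diag_coef n t : R := M t ('X * (P n t * P n t)) / sqnorm n t.

Section FixedParameters.
Variables (t : 'rV[R]_m) (it : increasing_params t).

Lemma size_P n : size (P n t) = n.+1.
Proof. by have [/(_ n)[]] := P_OPS it. Qed.

Lemma coef_P n : (P n t)`_n = 1.
Proof. by have [/(_ n)[/monicP]] := P_OPS it; rewrite /lead_coef size_P. Qed.

Lemma orth_P j k : j <> k -> M t (P j t * P k t) = 0.
Proof.
move=> jk; rewrite -integralR_poly_weight; have [_ /(_ j k jk) <-] := P_OPS it.
by congr integralR; apply/funext => x; rewrite hornerM.
Qed.

Lemma sqnorm_gt0 n : 0 < sqnorm n t.
Proof. by apply: mom_pos => //; rewrite -size_poly_gt0 size_P. Qed.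

Lemma sqnorm_neq0 n : sqnorm n t != 0.
Proof. by rewrite gt_eqF// sqnorm_gt0. Qed.

Lemma hnormE n : hnorm omega P n t = sqnorm n t.
Proof.
rewrite /sqnorm -integralR_poly_weight; congr integralR.
by apply/funext => x; rewrite hornerM expr2.
Qed.

Lemma size_sub_lead p n : (size p <= n.+1)%N -> (size (p - p`_n *: P n t)%R <= n)%N.
Proof.
move=> pn; apply/leq_sizeP => j; rewrite leq_eqVlt coefB coefZ => /orP[/eqP <-|nj].
  by rewrite coef_P mulr1 subrr.
by rewrite (nth_default _ (leq_trans pn nj)) [_`_j]nth_default ?size_P// mulr0 subr0.
Qed.

(** Multiples of P_(n-1), P_(n-2), ... are peeled off q in turn, each cancelling the top
    coefficient. *)
Lemma orth_span n p q : (forall j, (j < n)%N -> M t (p * P j t) = 0) ->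
  (size q <= n)%N -> M t (p * q) = 0.
Proof.
elim: n q => [|n IH] q h qn.
  by move: qn; rewrite leqn0 size_poly_eq0 => /eqP ->; rewrite mulr0 raddf0.
rewrite -(subrK (q`_n *: P n t) q) mulrDr momD -scalerAr momZ h// mulr0 addr0.
by apply: IH => [j jn|]; [exact: h (leqW jn)|exact: size_sub_lead].
Qed.

Lemma orth_low n q : (size q <= n)%N -> M t (P n t * q) = 0.
Proof. by apply: orth_span => j jn; apply: orth_P => nj; rewrite nj ltnn in jn. Qed.

(** Such a p is orthogonal to itself, against positivity unless it is 0. *)
Lemma orth_unique n p : (size p <= n)%N ->
  (forall j, (j < n)%N -> M t (p * P j t) = 0) -> p = 0.
Proof.
move=> pn h; apply/eqP; apply: contraT => p0.
by have := mom_pos it p0; rewrite (orth_span h pn) ltxx.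
Qed.

Lemma orth_unique_eq n p q : (size p <= n)%N -> (size q <= n)%N ->
  (forall j, (j < n)%N -> M t (p * P j t) = M t (q * P j t)) -> p = q.
Proof.
move=> pn qn h; apply/eqP; rewrite -subr_eq0; apply/eqP; apply: (@orth_unique n).
  by rewrite (leq_trans (size_polyD _ _))// geq_max size_polyN pn.
by move=> j jn; rewrite mulrBl momB h// subrr.
Qed.

(** After subtracting X^n both sides have degree below n and the same pairing with each lower P_j.
    The formula gives access to the dependence of P_n on t. *)
Lemma gram_schmidt n : P n t =
  'X^n - \sum_(j < n) (M t ('X^n * P j t) / sqnorm j t) *: P j t.
Proof.
apply: (@addIr _ (- 'X^n)); rewrite [in RHS]addrAC subrr sub0r.
apply: (@orth_unique_eq n).
- have := @size_sub_lead 'X^n n; rewrite size_polyXn leqnn coefXn eqxx scale1r.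
  by move=> /(_ isT); rewrite -size_polyN opprB.
- rewrite size_polyN; apply: (leq_trans (size_sum _ _ _)); apply/bigmax_leqP => j _.
  by rewrite (leq_trans (size_scale_leq _ _))// size_P.
- move=> j jn; rewrite mulrBl momB orth_low ?size_P// sub0r mulNr momN mulr_suml mom_sum.
  congr (- _); rewrite (bigD1 (Ordinal jn))//= big1 ?addr0.
    by rewrite -scalerAl momZ -/(sqnorm j t) divfK ?sqnorm_neq0.
  move=> i ij; rewrite -scalerAl momZ orth_P ?mulr0// => e.
  by move/eqP: ij; apply; apply: val_inj.
Qed.


Lemma size_mulX_sub_P n : (size ('X * P n t - P n.+1 t)%R <= n.+1)%N.
Proof.
have := @size_sub_lead ('X * P n t) n.+1.
rewrite coefXM/= coef_P scale1r; apply.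
by rewrite (leq_trans (size_polyMleq _ _))// size_polyX size_P.
Qed.

(** x P_n and P_(n+1) differ by a polynomial of degree at most n. *)
Lemma mom_mulX_P n : M t ('X * (P n t * P n.+1 t)) = sqnorm n.+1 t.
Proof.
have -> : 'X * (P n t * P n.+1 t) =
    P n.+1 t * ('X * P n t - P n.+1 t) + P n.+1 t * P n.+1 t by ring.
by rewrite momD orth_low ?size_mulX_sub_P// add0r.
Qed.

Lemma size_deriv_P n : (size (P n t)^`() <= n)%N.
Proof. by have := lt_size_deriv (p := P n t); rewrite size_P -size_poly_gt0 size_P ltnS; apply. Qed.

End FixedParameters.

(** Strong induction on n: near t the Gram-Schmidt formula builds P_n from the lower P_j, their
    moments and inverses of nonzero norms. *)
Lemma hasLp_P_ex n t : increasing_params t -> exists dp, hasLp (P n) t dp.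
Proof.
move=> it; have [N] := ubnP n; elim: N n => // N IH n nN.
have h (j : 'I_n) : {dp | hasLp (P j) t dp}.
  by apply: cid; apply: IH; rewrite (leq_trans (ltn_ord j)).
eexists; apply: (@hasLp_near _ _ (fun s => 'X^n -
    \sum_(j < n) (M s ('X^n * P j s) / sqnorm j s) *: P j s)).
  by apply: near_row_mono (near_increasing it) => s is_; rewrite -gram_schmidt.
under eq_fun do rewrite -mulN1r mulr_sumr.
apply: hasLp_add; first exact: hasLp_cst.
apply: hasLp_sum => j; apply: hasLp_mul; first exact: hasLp_cst.
apply: hasLp_scale; last exact: (projT2 (h j)).
apply: hasL_mul.
  by apply: hasL_mom; apply: hasLp_mul; [exact: hasLp_cst|exact: (projT2 (h j))].
apply: hasL_inv; first exact: sqnorm_neq0.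
by apply: hasL_mom; apply: hasLp_mul; exact: (projT2 (h j)).
Qed.

(** Near t the coefficient of degree n is constantly 1 and those above it are 0, so the derivative
    has degree below n. *)
Lemma hasLp_P n t : increasing_params t ->
  exists2 dp, hasLp (P n) t dp & (size dp <= n)%N.
Proof.
move=> it; have [dp h] := hasLp_P_ex n it; exists dp => //.
apply/leq_sizeP => j nj; have [_ /(_ j) hj] := h.
apply: hasL_inj hj _.
apply: (@hasL_near _ _ (fun=> (j == n)%:R)); last exact: hasL_cst.
apply: near_row_mono (near_increasing it) => s is_.
move: nj; rewrite leq_eqVlt => /orP[/eqP <-|nj]; first by rewrite eqxx coef_P.
by rewrite gtn_eqF// nth_default// size_P.
Qed.

Section Flow.
Variables (t : 'rV[R]_m) (it : increasing_params t).

(** Differentiates the relation that P_n and P_j are orthogonal. The term with P_n times the flow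
    derivative of P_j drops out, that derivative having degree below n. *)
Lemma flow_orth n j dn dj : (j < n)%N -> hasLp (P n) t dn -> hasLp (P j) t dj ->
  (size dj <= j)%N ->
  M t ((dn + (P n t)^`()) * P j t) = 2 * M t ('X * (P n t * P j t)).
Proof.
move=> jn hn hj sj.
have h0 : hasL (fun s => M s (P n s * P j s)) t 0.
  apply: (@hasL_near _ _ (fun=> 0)); last exact: hasL_cst.
  apply: near_row_mono (near_increasing it) => s is_; rewrite orth_P//.
  by move=> nj; rewrite nj ltnn in jn.
have := hasL_inj (hasL_mom omega (hasLp_mul hn hj)) h0.
rewrite derivM.
have -> : P n t * dj + P j t * dn + ((P n t)^`() * P j t + P n t * (P j t)^`())
     - 2 *: ('X * (P n t * P j t))
   = (dn + (P n t)^`()) * P j t + P n t * (dj + (P j t)^`()) - 2 *: ('X * (P n t * P j t)).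
  by ring.
rewrite momB momD momZ [M t (P n t * _)]orth_low//; first by rewrite addr0 => /eqP; rewrite subr_eq0 => /eqP.
rewrite (leq_trans (size_polyD _ _))// geq_max (leq_trans sj (ltnW jn))/=.
by rewrite (leq_trans (size_deriv_P it j))// ltnW.
Qed.

Lemma size_flow n (dn : {poly R}) : (size dn <= n)%N -> (size (dn + (P n t)^`())%R <= n)%N.
Proof.
by move=> sn; rewrite (leq_trans (size_polyD _ _))// geq_max sn size_deriv_P.
Qed.

(** Both expressions for the flow derivative have degree at most n and are tested on P_0, ..., P_n:
    below n by [flow_orth], at n by the choice of a_n. This form involves no P_(n-1), so it also
    covers n = 0. *)
Lemma hasLp_P_up n :
  hasLp (P n) t (2 *: (('X - (diag_coef n t)%:P) * P n t - P n.+1 t) - (P n t)^`()).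
Proof.
have [dn hn sn] := hasLp_P n it.
apply: (hasLp_eq hn); apply/eqP; rewrite eq_sym subr_eq; apply/eqP/esym.
apply: (@orth_unique_eq _ it n.+1).
- exact: leqW (size_flow sn).
- rewrite (leq_trans (size_scale_leq _ _))//.
  rewrite mulrBl addrAC (leq_trans (size_polyD _ _))// geq_max size_mulX_sub_P//=.
  by rewrite size_polyN mul_polyC (leq_trans (size_scale_leq _ _))// size_P.
move=> j; rewrite ltnS leq_eqVlt -scalerAl momZ => /orP[/eqP ->|jn].
  rewrite mulrC orth_low ?size_flow//.
  have -> : (('X - (diag_coef n t)%:P) * P n t - P n.+1 t) * P n t =
     'X * (P n t * P n t) - diag_coef n t *: (P n t * P n t) - P n.+1 t * P n t.
    by rewrite -mul_polyC; ring.
  rewrite !momB momZ [M t (P n.+1 t * _)]orth_low ?size_P// /diag_coef -/(sqnorm n t) divfK ?sqnorm_neq0//.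
  by rewrite subrr subr0 mulr0.
have [dj hj sj] := hasLp_P j it.
rewrite (flow_orth jn hn hj sj); congr (_ * _).
have -> : (('X - (diag_coef n t)%:P) * P n t - P n.+1 t) * P j t =
   'X * (P n t * P j t) - diag_coef n t *: (P n t * P j t) - P n.+1 t * P j t.
  by rewrite -mul_polyC; ring.
by rewrite !momB momZ !orth_low ?size_P ?leqW// mulr0 !subr0.
Qed.

(** The flow derivative of P_(n+1) has degree at most n and pairs to 0 with every P_j for j < n,
    hence is a multiple of P_n; [mom_mulX_P] gives the factor 2 b_(n+1) = 2 h_(n+1) / h_n. *)
Lemma hasLp_P_down n :
  hasLp (P n.+1) t ((2 * (sqnorm n.+1 t / sqnorm n t)) *: P n t - (P n.+1 t)^`()).
Proof.
have [dn hn sn] := hasLp_P n.+1 it.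
apply: (hasLp_eq hn); apply/eqP; rewrite eq_sym subr_eq; apply/eqP/esym.
apply: (@orth_unique_eq _ it n.+1); first exact: size_flow.
  by rewrite (leq_trans (size_scale_leq _ _))// size_P.
move=> j jn.
have [dj hj sj] := hasLp_P j it.
rewrite (flow_orth jn hn hj sj) -scalerAl momZ -mulrA; congr (_ * _).
move: jn; rewrite ltnS leq_eqVlt => /orP[/eqP ->|jn].
  by rewrite [P n.+1 t * _]mulrC mom_mulX_P// -/(sqnorm n t) divfK// sqnorm_neq0.
rewrite [M t (P n t * _)]orth_low ?size_P// mulr0.
rewrite mulrCA orth_low// (leq_trans (size_polyMleq _ _))// size_polyX size_P//.
Qed.

(** The flow derivative of P_n is orthogonal to P_n, so only the Gaussian factor contributes. *)
Lemma hasL_sqnorm n : hasL (sqnorm n) t (- 2 * diag_coef n t * sqnorm n t).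
Proof.
have [dn hn sn] := hasLp_P n it.
apply: hasL_eq (hasL_mom omega (hasLp_mul hn hn)) _; rewrite derivM.
have -> : P n t * dn + P n t * dn + ((P n t)^`() * P n t + P n t * (P n t)^`())
     - 2 *: ('X * (P n t * P n t))
   = P n t * (dn + (P n t)^`()) + P n t * (dn + (P n t)^`()) - 2 *: ('X * (P n t * P n t)).
  by ring.
rewrite momB momD momZ !orth_low ?size_flow// /diag_coef.
by have := sqnorm_neq0 it n; move=> h; field.
Qed.

(** The quantity B_n, the normalized second moment of P_n^2 w. *)
Definition second_coef n : R := M t ('X * ('X * (P n t * P n t))) / sqnorm n t.

(** In the numerator of a_(n+1) the factor x contributes 1, the two factors P_(n+1) contribute 4
    b_(n+1), and the Gaussian factor - 2 B_(n+1); the norm in the denominator adds 2 a_(n+1)^2. *)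
Lemma hasL_diag_coef n : hasL (diag_coef n.+1) t
  (1 + 4 * (sqnorm n.+1 t / sqnorm n t) - 2 * second_coef n.+1 + 2 * diag_coef n.+1 t ^+ 2).
Proof.
have hn := hasLp_P_down n.
have h0 := sqnorm_neq0 it n.+1.
have h0' := sqnorm_neq0 it n.
apply: hasL_eq.
  apply: (@hasL_mul _ _ (fun s => M s ('X * (P n.+1 s * P n.+1 s)))
    (fun s => (sqnorm n.+1 s)^-1)); last exact: hasL_inv h0 (hasL_sqnorm n.+1).
  exact: (hasL_mom omega (hasLp_mul (hasLp_cst (polyX R) t) (hasLp_mul hn hn))).
rewrite derivM derivX derivM.
set b := sqnorm n.+1 t / _.
set p := P n.+1 t; set q := P n t.
have -> : 'X * (p * ((2 * b) *: q - p^`()) + p * ((2 * b) *: q - p^`())) + p * p * 0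
    + (1 * (p * p) + 'X * (p^`() * p + p * p^`())) - 2 *: ('X * ('X * (p * p)))
  = p * p + (4 * b) *: ('X * (q * p)) - 2 *: ('X * ('X * (p * p))).
  by rewrite -!mul_polyC !polyCM; ring.
rewrite momB momD !momZ mom_mulX_P// -/(sqnorm n.+1 t) /second_coef /diag_coef -/p /b.
by field; rewrite h0 h0'.
Qed.

(** [mom_parts] for P_n^2, where 2 P_n P_n' has moment 0. *)
Lemma sum_jump_P n :
  \sum_(k < m) jump omega t k * (P n t).[tcoord t k] ^+ 2 = 2 * M t ('X * (P n t * P n t)).
Proof.
have := mom_parts omega t (P n t * P n t).
rewrite derivM [_^`() * _]mulrC momD !orth_low ?size_deriv_P// addr0 sub0r addrC.
move=> /eqP; rewrite subr_eq0 => /eqP <-.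
by apply: eq_bigr => k _; rewrite hornerM expr2.
Qed.

(** [mom_parts] for x P_n^2, where x P_n' is n P_n plus terms of lower degree. *)
Lemma sum_jump_XP n :
  \sum_(k < m) jump omega t k * (tcoord t k * (P n t).[tcoord t k] ^+ 2) =
  2 * M t ('X * ('X * (P n t * P n t))) - (2 * n%:R + 1) * sqnorm n t.
Proof.
have := mom_parts omega t ('X * (P n t * P n t)).
have e : ('X * (P n t * P n t))^`() = (2 * n%:R + 1) *: (P n t * P n t)
     + 2 *: (P n t * ('X * (P n t)^`() - n%:R *: P n t)).
  by rewrite !derivM derivX -!mul_polyC polyCD polyCM; ring.
have s : (size ('X * (P n t)^`() - n%:R *: P n t)%R <= n)%N.
  have -> : n%:R = ('X * (P n t)^`())`_n.
    case: (n) => [|n']; first by rewrite coefXM.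
    by rewrite coefXM/= coef_deriv coef_P.
  apply: size_sub_lead => //.
  rewrite (leq_trans (size_polyMleq _ _))// size_polyX/=.
  by rewrite (leq_ltn_trans (size_deriv_P it n)).
rewrite e momD !momZ (orth_low it s) mulr0 addr0 -/(sqnorm n t).
under eq_bigr do rewrite !hornerM hornerX -expr2.
by move=> h; apply/eqP; rewrite -subr_eq0; apply/eqP; apply: etrans h; ring.
Qed.

End Flow.
End OrthogonalPolynomials.

(** * The flow of the values at the nodes and of R_(n,k) *)

Section LadderAtNodes.
Context {R : realType} {m : nat} (omega : nat -> R) (P : nat -> 'rV[R]_m -> {poly R}).
Implicit Types (t s : 'rV[R]_m).

Hypothesis P_OPS : monic_OPS omega P.
Hypothesis mom_pos : forall t p, increasing_params t -> p != 0 -> 0 < mom omega t (p * p).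

Local Notation h := (sqnorm omega P).
Local Notation alpha := (diag_coef omega P).
Local Notation v := (jump omega).

Definition node_val n (k : 'I_m) t : R := (P n t).[t 0 k].

Lemma hasL_node_val_down n k t : increasing_params t ->
  hasL (node_val n.+1 k) t (2 * (h n.+1 t / h n t) * node_val n k t).
Proof.
move=> it; apply: hasL_eq (hasLp_horner k (hasLp_P_down P_OPS mom_pos it n)) _.
by rewrite subrK hornerZ.
Qed.

Lemma hasL_node_val_up n k t : increasing_params t ->
  hasL (node_val n k) t
    (2 * ((tcoord t k - alpha n t) * node_val n k t - node_val n.+1 k t)).
Proof.
move=> it; apply: hasL_eq (hasLp_horner k (hasLp_P_up P_OPS mom_pos it n)) _.
by rewrite subrK !hornerE.
Qed.

Lemma RnkE n k t :
  Rnk omega P n k t = v t k * (node_val n k t * node_val n k t) * (h n t)^-1.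
Proof. by rewrite /Rnk hnormE expr2. Qed.

(** The closed form of L R_k at degree n+1, ready for a second differentiation; its last summand is
    4 r_k, normalized by h_n. *)
Definition flow_Rnk n k t : R :=
  2 * ((alpha n.+1 t - t 0 k) * Rnk omega P n.+1 k t)
  + 4 * (v t k * (node_val n.+1 k t * node_val n k t) * (h n t)^-1).

Lemma hasL_Rnk n k t : increasing_params t ->
  hasL (Rnk omega P n.+1 k) t (flow_Rnk n k t).
Proof.
move=> it.
have h0 := sqnorm_neq0 P_OPS mom_pos it n.+1.
have h0' := sqnorm_neq0 P_OPS mom_pos it n.
have hp := hasL_node_val_down n k it.
apply: (@hasL_near _ _ (fun s => v s k * (node_val n.+1 k s * node_val n.+1 k s) * (h n.+1 s)^-1)).
  by apply: near_row_mono (near_increasing it) => s is_; rewrite RnkE.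
apply: hasL_eq.
  apply: hasL_mul; last exact: hasL_inv h0 (hasL_sqnorm P_OPS mom_pos it n.+1).
  exact: hasL_mul (hasL_jump omega t k) (hasL_mul hp hp).
rewrite /flow_Rnk RnkE /tcoord.
by field; rewrite h0 h0'.
Qed.

(** In L r_k the terms with t_k and a_n cancel, leaving 2 r_k^2 / R_k - 2 b R_k with b = h_(n+1) /
    h_n. The resulting - 8 b R_k cancels against 2 R_k times the term 4 b of L a_(n+1), and the
    terms in r_k all go into (L R_k)^2 / (2 R_k). *)
Lemma hasL_flow_Rnk n k t : increasing_params t -> Rnk omega P n.+1 k t != 0 ->
  hasL (flow_Rnk n k) t
    (flow_Rnk n k t ^+ 2 / (2 * Rnk omega P n.+1 k t)
     + Rnk omega P n.+1 k t *
       (2 * (alpha n.+1 t - t 0 k) ^+ 2 - 4 * (second_coef omega P t n.+1 - alpha n.+1 t ^+ 2))).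
Proof.
move=> it R0.
have h0 := sqnorm_neq0 P_OPS mom_pos it n.+1.
have h0' := sqnorm_neq0 P_OPS mom_pos it n.
have hp := hasL_node_val_down n k it.
have hq := hasL_node_val_up n k it.
have hR := hasL_Rnk n k it.
have ht : hasL (fun s => s 0 k) t 1.
  by apply: (hasL_coord (F := id)); exact: is_derive_id.
apply: hasL_eq.
  apply: hasL_add; apply: hasL_scale; apply: hasL_mul.
  - exact: hasL_sub (hasL_diag_coef P_OPS mom_pos it n) ht.
  - exact: hR.
  - exact: hasL_mul (hasL_jump omega t k) (hasL_mul hp hq).
  - exact: hasL_inv h0' (hasL_sqnorm P_OPS mom_pos it n).
move: R0; rewrite /flow_Rnk RnkE /tcoord => R0.
(* R_k stands in a denominator, so its nonvanishing is passed on to its factors. *)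
have /andP[v0 p0] : (v t k != 0) && (node_val n.+1 k t != 0).
  by move: R0; rewrite !mulf_eq0 !negb_or => /andP[/andP[-> /andP[-> _]] _].
by field; rewrite h0 h0' v0 p0.
Qed.

End LadderAtNodes.

Theorem theorem3p6 (R : realType) (m n : nat) (omega : nat -> R)
    (P : nat -> 'rV[R]_m -> {poly R}) (t : 'rV[R]_m) :
  (1 <= m)%N -> (1 <= n)%N ->
  increasing_params t ->
  (forall l : nat, (l <= m)%N -> 0 <= \sum_(k < l.+1) omega k) ->
  (exists x : R, weight omega t x != 0) ->
  monic_OPS omega P ->
  forall k : 'I_m, Rnk omega P n k t != 0 ->
    (forall j : 'I_m, derivable (Rnk omega P n k) t (evec j) /\
                      derivable (Lop (Rnk omega P n k)) t (evec j)) /\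
    Lop (Lop (Rnk omega P n k)) t
      - (Lop (Rnk omega P n k) t) ^+ 2 / (2 * Rnk omega P n k t)
    = Rnk omega P n k t *
        (3 / 2 * (\sum_(j < m) Rnk omega P n j t) ^+ 2
         - 2 * \sum_(j < m) (tcoord t k + tcoord t j) * Rnk omega P n j t
         + 2 * (tcoord t k ^+ 2 - 2 * n%:R - 1)).
Proof.
(* From here on the degree is n+1, which gives it a lower neighbour P_n. *)
move=> _; case: n => // n _ it omega_ge0 w0 P_OPS k R0.
(* Differentiation at t requires positivity at nearby parameters too, whereas the weight is known to
   be nonzero only at t. *)
have mom_pos (s : 'rV[R]_m) p : increasing_params s -> p != 0 -> 0 < mom omega s (p * p).
  move=> is_; apply: mom_sqr_gt0 => //.
  exact: (weight_gt0_itv omega_ge0 it is_ w0).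
have [d1 L1] := hasL_Rnk P_OPS mom_pos n k it.
(* The closed form must hold on a neighbourhood of t for L to be applied to it again. *)
have near_flow : \forall s \near t, flow_Rnk omega P n k s = Lop (Rnk omega P n.+1 k) s.
  apply: near_row_mono (near_increasing it) => s is_.
  by have [_ ->] := hasL_Rnk P_OPS mom_pos n k is_.
have [d2 L2] := hasL_near near_flow (hasL_flow_Rnk P_OPS mom_pos it R0).
split; first by move=> j.
rewrite L2 L1 addrAC subrr add0r; congr (_ * _).
have h0 := sqnorm_neq0 P_OPS mom_pos it n.+1.
have s1 : \sum_(j < m) Rnk omega P n.+1 j t = 2 * diag_coef omega P n.+1 t.
  rewrite /diag_coef mulrA -(sum_jump_P P_OPS it) mulr_suml.
  by apply: eq_bigr => j _; rewrite /Rnk hnormE.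
have s2 : \sum_(j < m) tcoord t j * Rnk omega P n.+1 j t =
    2 * second_coef omega P t n.+1 - (2 * n.+1%:R + 1).
  transitivity ((\sum_(j < m) jump omega t j * (tcoord t j * (P n.+1 t).[tcoord t j] ^+ 2))
    / sqnorm omega P n.+1 t).
    rewrite mulr_suml; apply: eq_bigr => j _; rewrite /Rnk hnormE /jump.
    by ring.
  by rewrite (sum_jump_XP P_OPS it) /second_coef; field.
have s3 : \sum_(j < m) (tcoord t k + tcoord t j) * Rnk omega P n.+1 j t =
    tcoord t k * (2 * diag_coef omega P n.+1 t)
    + (2 * second_coef omega P t n.+1 - (2 * n.+1%:R + 1)).
  by rewrite -s1 -s2 mulr_sumr -big_split; apply: eq_bigr => j _; rewrite mulrDl.
(* The bracket 2 (a - t_k)^2 - 4 (B - a^2) equals 6 a^2 - 4 a t_k + 2 t_k^2 - 4 B, and 6 a^2 is 3/2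
   times the square of the sum of the R_j. *)
by rewrite s1 s3 /tcoord; field.
Qed.
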